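(* Let $f$ be a convex differentiable real-valued function on the space $\mathbb{S}^{n\times n}$ of symmetric real $n\times n$ matrices, with finite curvature constant $C_f$ with respect to $\boxplus:=\{X\in\mathbb{S}^{n\times n} : X\succeq0,\ X_{ii}\le1\ \forall i\}$. Let $X^*\in\boxplus$ be an optimal solution of $\min_{X\in\boxplus}f(X)$. For each $k\ge1$, the iterate $X^{(k)}$ of the algorithm ''Sparse Greedy for Max-Norm Bounded Semidefinite Optimization'' satisfies $$f(X^{(k)})-f(X^* )\le\frac{8C_f}{k+2}.$$ Furthermore, for any $\varepsilon>0$, after at most $2\left\lceil\frac{8C_f}{\varepsilon}\right\rceil+1=O\left(\frac1\varepsilon\right)$ many steps, the algorithm (with the step-size in the second half of the iterations fixed to $\frac{2}{K+2}$, where $K:=\lceil8C_f/\varepsilon\rceil$) has an iterate $X^{(k)}$ with $g(X^{(k)})\le\varepsilon$.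
   Context: $\mathbb{S}^{n\times n}$ carries the Frobenius inner product $A\bullet B:=\mathrm{Tr}(A^TB)$, with respect to which gradients are taken. The $O(\cdot)$ is for $\varepsilon\to0$, with constant depending only on $C_f$. Curvature constant: $$C_f:=\sup_{\substack{X,V\in\boxplus,\ \alpha\in(0,1],\\ Y=X+\alpha(V-X)}}\frac{1}{\alpha^2}\bigl(f(Y)-f(X)-(Y-X)\bullet\nabla f(X)\bigr).$$ Duality gap at $X\in\boxplus$: $g(X):=\max_{Y\in\boxplus}(X-Y)\bullet\nabla f(X)$. Algorithm ''Sparse Greedy for Max-Norm Bounded Semidefinite Optimization'': set $X^{(0)}:=vv^T$ for an arbitrary unit vector $v\in\mathbb{R}^n$. For $k=0,1,2,\dots$: let $\alpha:=\frac{2}{k+2}$; compute any $S\in\boxplus$ with $S\bullet\nabla f(X^{(k)})\le\min_{Y\in\boxplus}Y\bullet\nabla f(X^{(k)})+\alpha C_f$; update $X^{(k+1)}:=X^{(k)}+\alpha(S-X^{(k)})$. For the duality gap statement, the step-sizes are $\alpha=\frac{2}{k+2}$ for $0\le k\le K$ and $\alpha=\frac{2}{K+2}$ for $K\le k\le2K+1$ (also in the accuracy $\alpha C_f$). *)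

(* Defs.v *)
From HB Require Import structures.
From mathcomp Require Import all_boot all_order all_algebra.
From mathcomp Require Import all_classical all_reals all_analysis.
From mathcomp Require Import ring lra.

Set Implicit Arguments.
Unset Strict Implicit.
Unset Printing Implicit Defensive.

Import Order.TTheory GRing.Theory Num.Theory.
Import numFieldNormedType.Exports.

Local Open Scope classical_set_scope.
Local Open Scope ring_scope.

Definition frob (R : realType) (n : nat) (A B : 'M[R]_n) : R := \tr (A^T *m B).

Section frob_theory.
Variables (R : realType) (n : nat).
Implicit Types A B C : 'M[R]_n.

Lemma frobE A B : frob A B = \sum_i \sum_j A i j * B i j.
Proof.
rewrite /frob /mxtrace exchange_big /=; apply: eq_bigr => j _.
by rewrite mxE; apply: eq_bigr => i _; rewrite mxE.
Qed.

Lemma frobC A B : frob A B = frob B A.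
Proof.
by rewrite !frobE; do 2!(apply: eq_bigr => ? _); rewrite mulrC.
Qed.

Lemma frobDl A B C : frob (A + B) C = frob A C + frob B C.
Proof. by rewrite /frob linearD mulmxDl linearD. Qed.

Lemma frobZl (a : R) A B : frob (a *: A) B = a * frob A B.
Proof. by rewrite /frob linearZ -scalemxAl linearZ. Qed.

Lemma frobBl A B C : frob (A - B) C = frob A C - frob B C.
Proof. by rewrite -scaleN1r frobDl frobZl mulN1r. Qed.

Lemma frobDr A B C : frob A (B + C) = frob A B + frob A C.
Proof. by rewrite frobC frobDl !(frobC A). Qed.

Lemma frobZr (a : R) A B : frob A (a *: B) = a * frob A B.
Proof. by rewrite frobC frobZl (frobC A). Qed.

Lemma frob_ge0 A : 0 <= frob A A.
Proof.
by rewrite frobE; do 2!(apply: sumr_ge0 => ? _); rewrite -expr2 sqr_ge0.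
Qed.

Lemma frob_eq0 A : frob A A = 0 -> A = 0.
Proof.
have pos (i j : 'I_n) : 0 <= A i j * A i j by rewrite -expr2 sqr_ge0.
rewrite frobE => /eqP; rewrite psumr_eq0 => [/allP A0|i _]; last exact: sumr_ge0.
apply/matrixP => i j; rewrite mxE.
have := A0 i (mem_index_enum _); rewrite psumr_eq0//= => /allP/(_ j).
by rewrite mem_index_enum mulf_eq0 orbb => /(_ isT)/eqP.
Qed.

Lemma frob_CauchySchwarz A B : frob A B ^+ 2 <= frob A A * frob B B.
Proof.
have := frob_ge0 A; rewrite le_eqVlt => /predU1P[/esym A0|A0].
  by rewrite (frob_eq0 A0) -(scale0r 0) !frobZl !mul0r expr0n.
rewrite -subr_ge0 -(pmulr_rge0 _ A0).
have := frob_ge0 (frob A A *: B - frob A B *: A).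
rewrite -scaleNr !(frobDl, frobDr, frobZl, frobZr) (frobC B A).
by congr (_ <= _); ring.
Qed.

Lemma sqrt_frobD A B :
  Num.sqrt (frob (A + B) (A + B)) <=
  Num.sqrt (frob A A) + Num.sqrt (frob B B).
Proof.
rewrite -(@ler_pXn2r _ 2)// ?nnegrE ?addr_ge0 ?sqrtr_ge0//.
rewrite sqrrD !sqr_sqrtr ?frob_ge0// !(frobDl, frobDr) (frobC B A).
have : frob A B <= Num.sqrt (frob A A) * Num.sqrt (frob B B).
  rewrite -sqrtrM ?frob_ge0//; apply: le_trans (ler_norm _) _.
  by rewrite -sqrtr_sqr ler_wsqrtr// frob_CauchySchwarz.
by rewrite mulr2n; lra.
Qed.

End frob_theory.

Lemma symmetricmxP (R : realType) (n : nat) (A : 'M[R]_n) :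
  reflect (A^T = A) (A \is symmetricmx).
Proof.
by apply: (iffP (is_hermitianmxP _ _ _)); rewrite expr0 scale1r map_mx_id//;
  move=> /esym.
Qed.

Definition symmx (R : realType) (n : nat) : {pred 'M[R]_n} :=
  fun A => A \is symmetricmx.

(* The space of symmetric real matrices, as a type of its own so that
   differentiability on it (not on all matrices) is the library's notion. *)
Record symmat (R : realType) (n : nat) := SymMat {
  symmat_mx :> 'M[R]_n;
  symmat_sym : symmat_mx \in @symmx R n }.

Section symmat_structure.
Variables (R : realType) (n : nat).

Fact symmx_submod_closed : submod_closed (@symmx R n).
Proof.
split=> [|a A B /symmetricmxP As /symmetricmxP Bs]; apply/symmetricmxP.
  by rewrite linear0.
by rewrite linearD linearZ /= As Bs.
Qed.

HB.instance Definition _ :=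
  GRing.isSubmodClosed.Build R 'M[R]_n (@symmx R n) symmx_submod_closed.

HB.instance Definition _ := [isSub for @symmat_mx R n].
HB.instance Definition _ := [Choice of symmat R n by <:].
HB.instance Definition _ := [SubChoice_isSubLmodule of symmat R n by <:].

Definition symmat_norm (A : symmat R n) : R := Num.sqrt (frob A A).

Fact symmat_normD (A B : symmat R n) :
  symmat_norm (A + B) <= symmat_norm A + symmat_norm B.
Proof. exact: sqrt_frobD. Qed.

Fact symmat_normZ (a : R) (A : symmat R n) :
  symmat_norm (a *: A) = `|a| * symmat_norm A.
Proof.
by rewrite /symmat_norm frobZl frobZr mulrA -expr2 sqrtrM ?sqr_ge0// sqrtr_sqr.
Qed.

Fact symmat_norm0 (A : symmat R n) : symmat_norm A = 0 -> A = 0.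
Proof.
move=> /eqP; rewrite sqrtr_eq0 => A0; apply/val_inj/frob_eq0/eqP.
by rewrite eq_le A0 frob_ge0.
Qed.

HB.instance Definition _ := @Lmodule_isNormed.Build R (symmat R n)
  symmat_norm symmat_normD symmat_normZ symmat_norm0.

End symmat_structure.

Section gradient.
Variables (R : realType) (n : nat).
Implicit Types (f : symmat R n -> R^o) (X H : symmat R n).

(* The Riesz representative of the differential; see [gradP], [grad_unique]. *)
Definition grad f X : symmat R n :=
  get (fun G : symmat R n => forall H, 'd f X H = frob G H).

Let sdelta (i j : 'I_n) : 'M[R]_n := 2^-1 *: (delta_mx i j + delta_mx j i).

Let sdelta_sym i j : sdelta i j \in @symmx R n.
Proof.
apply/symmetricmxP.
by rewrite /sdelta linearZ linearD /= !trmx_delta addrC.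
Qed.

Let sdeltaC i j : SymMat (sdelta_sym i j) = SymMat (sdelta_sym j i).
Proof. by apply: val_inj; rewrite /= /sdelta addrC. Qed.

Let symmat_sum_sdelta H :
  H = \sum_i \sum_j (H : 'M[R]_n) i j *: SymMat (sdelta_sym i j).
Proof.
have Hs : (H : 'M[R]_n)^T = H by apply/symmetricmxP; exact: symmat_sym.
have valsum (F : 'I_n -> symmat R n) :
    symmat_mx (\sum_i F i) = \sum_i symmat_mx (F i).
  exact: (raddf_sum (\val : {additive symmat R n -> 'M[R]_n})).
apply: val_inj; rewrite /= [LHS](matrix_sum_delta (symmat_mx H)) valsum.
under [RHS]eq_bigr do rewrite valsum /=.
under [RHS]eq_bigr => i _ do under eq_bigr => j _ do
  rewrite /sdelta scalerA mulrC -scalerA scalerDr.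
under [RHS]eq_bigr do rewrite -scaler_sumr big_split /=.
rewrite -scaler_sumr big_split /= [X in _ *: (_ + X)]exchange_big /=.
under [X in _ *: (_ + X)]eq_bigr => i _ do
  under eq_bigr => j _ do rewrite -[in X in X *: _]Hs mxE.
rewrite -mulr2n -scalerMnr scalerMnl -mulr_natr mulVf ?pnatr_eq0//.
by rewrite scale1r.
Qed.

Lemma gradP f X : forall H, 'd f X H = frob (grad f X) H.
Proof.
pose G := \matrix_(i, j) ('d f X (SymMat (sdelta_sym i j)) : R) : 'M[R]_n.
have Gs : G \in @symmx R n.
  by apply/symmetricmxP/matrixP => i j; rewrite !mxE sdeltaC.
apply: (@getPex _ (fun G : symmat R n => forall H, 'd f X H = frob G H)).
exists (SymMat Gs) => H; rewrite {1}(symmat_sum_sdelta H) linear_sum frobE /=.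
apply: eq_bigr => i _; rewrite linear_sum; apply: eq_bigr => j _.
by rewrite linearZ /= mxE mulrC.
Qed.

Lemma grad_unique f X (G : symmat R n) :
  (forall H, 'd f X H = frob G H) -> G = grad f X.
Proof.
move=> GH; apply/eqP; rewrite -subr_eq0; apply/eqP/val_inj/frob_eq0.
by rewrite [in X in frob X _]/= frobBl -(GH (G - grad f X)) -gradP subrr.
Qed.

End gradient.

Section max_norm_box.
Variables (R : realType) (n : nat).
Implicit Types (f : symmat R n -> R^o) (X Y V S : symmat R n).

Definition psd X : Prop := forall v : 'cV[R]_n, 0 <= (v^T *m X *m v) 0 0.

Definition box : set (symmat R n) :=
  [set X | psd X /\ forall i, (X : 'M[R]_n) i i <= 1].

Definition is_optimal f X : Prop :=
  box X /\ forall Y, box Y -> f X <= f Y.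

Definition curvature f : \bar R :=
  ereal_sup [set c | exists X V (a : R),
    [/\ box X, box V, 0 < a <= 1 &
        let Y := X + a *: (V - X) in
        c = (a ^- 2 * (f Y - f X - frob (Y - X) (grad f X)))%:E]].

(* The maximum and the minimum of linear functionals over [box] are written
   [sup] and [inf]; both are attained, see [gap_attained], [lin_min_attained]. *)
Definition gap f X : R := sup [set frob (X - Y) (grad f X) | Y in box].

Definition lin_min (G : symmat R n) : R := inf [set frob Y G | Y in box].

Lemma box_nonempty : @box !=set0.
Proof.
exists 0; split=> [v|i] /=; last by rewrite mxE ler01.
by rewrite mulmx0 mul0mx mxE.
Qed.

Let quadE (A : 'M[R]_n) (v : 'cV[R]_n) :
  (v^T *m A *m v) 0 0 = \sum_i \sum_j v i 0 * v j 0 * A i j.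
Proof.
rewrite mxE exchange_big /=; apply: eq_bigr => j _; rewrite mxE mulr_suml.
by apply: eq_bigr => i _; rewrite mxE mulrAC.
Qed.

Let box_entry X i j : box X -> `|(X : 'M[R]_n) i j| <= 1.
Proof.
move=> [psdX X1].
have Xs : (X : 'M[R]_n)^T = X by apply/symmetricmxP; exact: symmat_sym.
have Xji : (X : 'M[R]_n) j i = (X : 'M[R]_n) i j by rewrite -[in LHS]Xs mxE.
have quad (s : R) : 0 <= X i i + s * X i j *+ 2 + s ^+ 2 * X j j.
  have := psdX (delta_mx i 0 + s *: delta_mx j 0).
  rewrite [(_ + _)^T]linearD /= [(_ *: _)^T]linearZ /= !trmx_delta.
  rewrite !(mulmxDl, mulmxDr) -?scalemxAl -?scalemxAr -?scalemxAl -!rowE.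
  by rewrite -!colE !mxE Xji; congr (_ <= _); ring.
have := quad 1; have := quad (-1); have := X1 i; have := X1 j.
by rewrite ler_norml; lra.
Qed.

Let mx_continuous (c : 'I_n -> 'I_n -> R) :
  continuous (fun w : 'rV[R]_(n * n) => \sum_i \sum_j c i j * (vec_mx w) i j).
Proof.
apply: (@continuous_big R _ _ _ _ add_continuous) => i _.
apply: (@continuous_big R _ _ _ _ add_continuous) => j _ w.
under eq_fun do rewrite mxE.
apply: (@cvgM _ _ (nbhs w) _ (cst (c i j)) (fun x => x ord0 (mxvec_index i j))).
  exact: cvg_cst.
exact: coord_continuous.
Qed.

Let closed_mx (c : 'I_n -> 'I_n -> R) (b : R) :
  closed [set w : 'rV[R]_(n * n) | \sum_i \sum_j c i j * (vec_mx w) i j <= b].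
Proof.
apply: (@preimage_closed _ _
  (fun w : 'rV[R]_(n * n) => \sum_i \sum_j c i j * (vec_mx w) i j)
  [set y | y <= b]) => [w _|]; [exact: mx_continuous | exact: closed_le].
Qed.

Let entryE (A : 'M[R]_n) i j :
  A i j = \sum_k \sum_l ((k == i) && (l == j))%:R * A k l.
Proof.
rewrite (bigD1 i)//= (bigD1 j)//= !eqxx mul1r big1 ?addr0 => [|l /negPf->].
  rewrite big1 ?addr0// => k /negPf->.
  by rewrite big1// => l _; rewrite mul0r.
by rewrite andbF mul0r.
Qed.

Let box_vec : set 'rV[R]_(n * n) := [set w |
  [/\ forall i j, (vec_mx w) i j - (vec_mx w) j i <= 0,
      forall v : 'cV[R]_n, - (v^T *m vec_mx w *m v) 0 0 <= 0 &
      forall i, (vec_mx w) i i <= 1]].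

Let box_vecP w : box_vec w ->
  exists2 X : symmat R n, box X & (X : 'M[R]_n) = vec_mx w.
Proof.
move=> [sw pw dw].
have ws : vec_mx w \in @symmx R n.
  apply/symmetricmxP/matrixP => i j; rewrite [LHS]mxE; apply/eqP.
  by rewrite eq_le -subr_le0 sw -subr_le0 sw.
by exists (SymMat ws) => //; split=> // v; rewrite -oppr_le0; exact: pw.
Qed.

Let mxvec_box X : box X -> box_vec (mxvec X).
Proof.
move=> [pX dX]; split=> [i j|v|i]; rewrite mxvecK//; last by rewrite oppr_le0.
have /symmetricmxP Xs := symmat_sym X.
by rewrite -[in X in _ - X]Xs mxE subrr.
Qed.

Let closed_box_vec : closed box_vec.
Proof.
pose cs (i j k l : 'I_n) : R :=
  ((k == i) && (l == j))%:R - ((k == j) && (l == i))%:R.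
rewrite (_ : box_vec =
  (\bigcap_i \bigcap_j
     [set w | \sum_k \sum_l cs i j k l * (vec_mx w) k l <= 0]) `&`
  (\bigcap_(v : 'cV[R]_n)
     [set w | \sum_k \sum_l - (v k 0 * v l 0) * (vec_mx w) k l <= 0]) `&`
  (\bigcap_i
     [set w | \sum_k \sum_l ((k == i) && (l == i))%:R * (vec_mx w) k l <= 1])).
  by apply: closedI; [apply: closedI|]; apply: closed_bigI => i _ //;
    apply: closed_bigI.
have csE (w : 'rV[R]_(n * n)) i j :
    \sum_k \sum_l cs i j k l * (vec_mx w) k l = vec_mx w i j - vec_mx w j i.
  rewrite (entryE (vec_mx w) i j) (entryE (vec_mx w) j i) -sumrB.
  apply: eq_bigr => k _; rewrite -sumrB; apply: eq_bigr => l _.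
  by rewrite mulrBl.
have qE (w : 'rV[R]_(n * n)) (v : 'cV[R]_n) :
    \sum_k \sum_l - (v k 0 * v l 0) * (vec_mx w) k l =
    - (v^T *m vec_mx w *m v) 0 0.
  rewrite quadE -sumrN; apply: eq_bigr => k _; rewrite -sumrN.
  by apply: eq_bigr => l _; rewrite mulNr.
apply/seteqP; split=> w.
- move=> [sw pw dw]; split; [split|] => /=.
  + by move=> i _ j _ /=; rewrite csE.
  + by move=> v _ /=; rewrite qE.
  + by move=> i _ /=; rewrite -entryE.
- move=> [[sw pw] dw]; split=> [i j|v|i].
  + by rewrite -csE; exact: (sw i I j I).
  + by rewrite -qE; exact: (pw v I).
  + by rewrite entryE; exact: (dw i I).
Qed.

Let compact_box_vec : compact box_vec.
Proof.
apply: (@subclosed_compact _ _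
  [set w : 'rV[R]_(n * n) | forall i, `[-1, 1]%classic (w ord0 i)]) closed_box_vec _ _.
  by apply: (@rV_compact R _ (fun=> `[-1, 1]%classic)) => i; exact: segment_compact.
move=> w /box_vecP[X /box_entry X1 Xw] k /=; rewrite in_itv /= -ler_norml.
by case/mxvec_indexP: k => i j; have := X1 i j; rewrite Xw mxE.
Qed.

Lemma lin_min_attained (G : symmat R n) :
  exists2 Y, box Y & frob Y G = lin_min G /\
    forall Z, box Z -> frob Y G <= frob Z G.
Proof.
have [w0 w0B] : box_vec !=set0.
  by have [X /mxvec_box] := box_nonempty; exists (mxvec X).
pose g (w : 'rV[R]_(n * n)) := \sum_i \sum_j (G : 'M[R]_n) i j * vec_mx w i j.
have [w /set_mem/box_vecP[Y bY Yw] gw] := @compact_EVT_min _ _ g box_vec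
  (ex_intro _ w0 w0B) compact_box_vec (continuous_subspaceT (@mx_continuous _)).
have Ymin Z : box Z -> frob Y G <= frob Z G.
  move=> /mxvec_box/mem_set/gw.
  by rewrite /g mxvecK -Yw -!frobE !(frobC G).
exists Y => //; split=> //; apply/eqP; rewrite eq_le; apply/andP; split.
  by apply: lb_le_inf => [|_ [Z bZ <-]]; [exists (frob Y G), Y | exact: Ymin].
by apply: ge_inf; [exists (frob Y G) => _ [Z bZ <-]; exact: Ymin | exists Y].
Qed.

Lemma gap_attained f X :
  exists2 Y, box Y & frob (X - Y) (grad f X) = gap f X /\
    forall Z, box Z -> frob (X - Z) (grad f X) <= frob (X - Y) (grad f X).
Proof.
have [Y bY [_ Ymin]] := lin_min_attained (grad f X).
have Ymax Z : box Z -> frob (X - Z) (grad f X) <= frob (X - Y) (grad f X).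
  by move=> /Ymin; rewrite !frobBl lerD2l lerN2.
exists Y => //; split=> //; apply/eqP; rewrite eq_le; apply/andP; split.
  by apply: ub_le_sup; [exists (frob (X - Y) (grad f X)) => _ [Z bZ <-];
    exact: Ymax | exists Y].
by apply: ge_sup => [|_ [Z bZ <-]];
  [exists (frob (X - Y) (grad f X)), Y | exact: Ymax].
Qed.

Definition greedy_init X : Prop :=
  exists v : 'cV[R]_n,
    \sum_i v i 0 ^+ 2 = 1 /\ (X : 'M[R]_n) = v *m v^T.

Definition greedy_step f (C a : R) X X' : Prop :=
  exists S, [/\ box S,
    frob S (grad f X) <= lin_min (grad f X) + a * C &
    X' = X + a *: (S - X)].

End max_norm_box.

Definition step_size (R : realType) (k : nat) : R := 2 / (k + 2)%:R.

Definition gap_step_size (R : realType) (K k : nat) : R :=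
  step_size R (if (k <= K)%N then k else K).

(* [absz] only serves to turn the ceiling, which is nonnegative, into a [nat]. *)
Definition gap_K (R : realType) (C eps : R) : nat :=
  `|Num.ceil (8 * C / eps)|%N.

(* Main.v *)
Require Import Defs.
From mathcomp Require Import all_boot all_order all_algebra.
From mathcomp Require Import all_classical all_reals all_analysis.
From mathcomp Require Import ring lra.

Import Order.TTheory GRing.Theory Num.Theory.
Import numFieldNormedType.Exports.

Local Open Scope classical_set_scope.
Local Open Scope ring_scope.

(** This is the Frank-Wolfe analysis.  Write h_k for the suboptimality
    f(X_k) - f(Xopt) and g for the duality gap.  Two inequalities carry
    everything.

    Descent ([greedy_step_descent]): the curvature constant bounds f along a
    segment of the box by its linearization plus a^2 C, and the chosen S
    minimizes the linearization up to a C, so a step of size a gives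
      f(X_{k+1}) <= f(X_k) - a g(X_k) + 2 a^2 C.

    Weak duality ([suboptimality_le_gap]): a convex function lies above its
    tangent, so h_k <= g(X_k).

    Together they give the recursion h_{k+1} <= (1 - a) h_k + 2 a^2 C, which
    for a = 2/(k+2) propagates the bound h_k <= 8C/(k+2) by induction
    ([greedy_primal_rate]); as a = 1 at k = 0, the starting point is forgotten
    after one step.

    For the gap ([greedy_gap]), suppose that it exceeds eps at all the iterates
    K+1, ..., 2K+1, where the step is constantly a = 2/(K+2).  Each of these
    K+1 steps then lowers f by at least a eps - 2 a^2 C, while only
    h_{K+1} <= 8C/(K+3) <= 4 a C is available.  Dividing by a and using
    a (K+1) <= 2, this forces eps (K+1) <= 8C, against 8C <= eps K. *)

Section greedy.
Variables (R : realType) (n : nat).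
Implicit Types (f : symmat R n -> R^o) (X Y V S : symmat R n) (a C : R).

Lemma box_convex X V a : 0 <= a <= 1 -> box X -> box V ->
  box (X + a *: (V - X)).
Proof.
move=> /andP[a0 a1] [pX dX] [pV dV]; split=> [v|i] /=.
  rewrite (_ : _ *m v = (1 - a) *: (v^T *m X *m v) + a *: (v^T *m V *m v)).
    rewrite mxE [X in X + _]mxE [X in _ + X]mxE.
    by rewrite addr_ge0// mulr_ge0// ?subr_ge0// ?pX ?pV.
  rewrite !(mulmxDr, mulmxDl) -!scalemxAr -!scalemxAl !(mulmxDr, mulmxDl).
  rewrite mulmxN mulNmx scalerBl scale1r scalerBr addrA.
  by rewrite addrAC.
by rewrite !mxE; have := dX i; have := dV i; nra.
Qed.

(** v v^T is positive semidefinite because its quadratic form at w is the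
    square of v^T w; its diagonal entries are squares that sum to 1. *)
Lemma greedy_init_box X : greedy_init X -> box X.
Proof.
move=> [v [v1 Xv]]; split=> [w|i]; rewrite Xv.
  rewrite mulmxA -mulmxA (_ : w^T *m v = (v^T *m w)^T).
    by rewrite mxE big_ord1 [X in X * _]mxE -expr2 sqr_ge0.
  by rewrite trmx_mul trmxK.
rewrite mxE big_ord1 mxE -expr2 -v1 (bigD1 i)//= lerDl.
by apply: sumr_ge0 => j _; rewrite sqr_ge0.
Qed.

(** A convex function lies above its tangents: convexity bounds every right
    difference quotient at X in direction Y - X by f Y - f X, and the quotients
    converge to the derivative in that direction. *)
Lemma convex_grad_le f X Y : convex_function setT f -> differentiable f X ->
  frob (Y - X) (grad f X) <= f Y - f X.
Proof.
move=> cf df; rewrite frobC -gradP -deriveE//.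
have /cvg_dnbhs_at_right dcvg : h^-1 *: ((f \o shift X) (h *: (Y - X)) - f X)
    @[h --> 0^'] --> 'D_(Y - X) f X by exact: diff_derivable.
apply: (cvgr_to_le dcvg); near=> h.
have h0 : 0 < h by [].
have h1 : h <= 1 by near: h; exact: nbhs_right_le.
have hI : Itv.spec (Itv.num_sem (R := R)) (Itv.Real `[0, 1]%Z) h.
  by rewrite /= /Itv.num_sem /= in_itv /= (ltW h0) h1 num_real.
have := cf (Itv.mk hI) Y X; rewrite !inE => /(_ I I).
rewrite convRE /= /unstable.onem => cfh.
rewrite /= ler_pdivrMl//; rewrite (_ : h *: (Y - X) + X = h *: Y + (1 - h) *: X).
  by move: cfh; rewrite /conv /=; nra.
by rewrite scalerBr scalerBl scale1r -addrA [- _ + X]addrC.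
Unshelve. all: by end_near.
Qed.

Lemma curvature_descent f C X V a : curvature f = C%:E ->
  box X -> box V -> 0 < a <= 1 ->
  f (X + a *: (V - X)) <= f X + a * frob (V - X) (grad f X) + a ^+ 2 * C.
Proof.
move=> fC bX bV a01; have a0 : 0 < a by case/andP: a01.
have : ((a ^- 2 * (f (X + a *: (V - X)) - f X
    - frob (X + a *: (V - X) - X) (grad f X)))%:E <= curvature f)%E.
  by apply: ereal_sup_ubound; exists X, V, a; split.
rewrite fC lee_fin [X + _ - X]addrC addKr frobZl ler_pdivrMl ?exprn_gt0//.
by move: (f _) => y; lra.
Qed.

(** A segment reduced to a point contributes 0 to the supremum. *)
Lemma curvature_ge0 f C : curvature f = C%:E -> 0 <= C.
Proof.
have [X bX] := @box_nonempty R n; move=> fC.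
have a01 : 0 < (1 : R) <= 1 by rewrite ltr01 lexx.
have := curvature_descent f C X X 1 fC bX bX a01.
by rewrite subrr scaler0 addr0 -(scale0r 0) frobZl; lra.
Qed.

Lemma lin_min_le (G Y : symmat R n) : box Y -> lin_min G <= frob Y G.
Proof. by have [Z _ [<-]] := lin_min_attained G; apply. Qed.

(** Weak duality: the gap is the largest decrease that the tangent at X
    predicts over the box, and by convexity the tangent overestimates the actual
    decrease. *)
Lemma suboptimality_le_gap f X Y : convex_function setT f ->
  differentiable f X -> box Y -> f X - f Y <= gap f X.
Proof.
move=> cf df bY; have [Z _ [<- /(_ Y bY)]] := gap_attained f X.
by have := convex_grad_le f X Y cf df; rewrite !frobBl; lra.
Qed.

(** The linear term of the descent is - a times the gap, except for the error
    a C allowed in S.  Scaled by the step a, that error is as large as the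
    curvature term, hence the factor 2. *)
Lemma greedy_step_descent f C a X X' : curvature f = C%:E ->
  0 < a <= 1 -> box X -> greedy_step f C a X X' ->
  f X' <= f X - a * gap f X + 2 * a ^+ 2 * C.
Proof.
move=> fC a01 bX [S [bS Sle ->]]; have /andP[a0 a1] := a01.
apply: le_trans (curvature_descent f C X S a fC bX bS a01) _.
have [Y bY [<- _]] := gap_attained f X.
have := lin_min_le (grad f X) Y bY; move: Sle; rewrite !frobBl; nra.
Qed.

Lemma greedy_step_box f C a X X' : 0 < a <= 1 -> box X ->
  greedy_step f C a X X' -> box X'.
Proof.
move=> /andP[a0 a1] bX [S [bS _ ->]].
by apply: box_convex => //; rewrite (ltW a0).
Qed.

Lemma step_size_bounds k : 0 < step_size R k <= 1.
Proof.
rewrite /step_size divr_gt0//= ?ltr0n ?addn_gt0 ?orbT//.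
by rewrite ler_pdivrMr ?ltr0n ?addn_gt0 ?orbT// mul1r ler_nat leq_addl.
Qed.

Lemma greedy_box f C (s : nat -> R) (X : nat -> symmat R n) (N : nat) :
  (forall k, 0 < s k <= 1) -> box (X 0%N) ->
  (forall k, (k < N)%N -> greedy_step f C (s k) (X k) (X k.+1)) ->
  forall k, (k <= N)%N -> box (X k).
Proof.
move=> s01 X0 Xs; elim=> // k IH kN.
by apply: greedy_step_box (Xs k kN); rewrite ?s01//; exact: IH (ltnW kN).
Qed.

(** The run is bounded by N because the two-phase schedule of [greedy_gap] agrees
    with 2/(k+2) only for the steps up to K. *)
Lemma greedy_primal_rate f C (Xopt : symmat R n) (X : nat -> symmat R n)
    (N : nat) :
  convex_function setT f -> (forall Y, differentiable f Y) ->
  curvature f = C%:E -> box Xopt -> box (X 0%N) ->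
  (forall k, (k < N)%N -> greedy_step f C (step_size R k) (X k) (X k.+1)) ->
  forall k, (0 < k <= N)%N -> f (X k) - f Xopt <= 8 * C / (k + 2)%:R.
Proof.
move=> cf df fC bopt X0 Xs; have C0 := curvature_ge0 f C fC.
have contract k : (k < N)%N -> let a := step_size R k in
    f (X k.+1) - f Xopt <= (1 - a) * (f (X k) - f Xopt) + 2 * a ^+ 2 * C.
  move=> kN /=; have s01 := step_size_bounds k; have /andP[s0 _] := s01.
  have bXk := greedy_box f C (step_size R) X N step_size_bounds X0 Xs k (ltnW kN).
  have := greedy_step_descent f C _ _ _ fC s01 bXk (Xs k kN).
  have := suboptimality_le_gap f (X k) Xopt cf (df _) bopt.
  by move: (f _) (f _) => u v; nra.
elim=> // -[|k] IH /= kN.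
  (* The first step has size 1, so h_1 <= 2C whatever h_0 is. *)
  have := contract 0%N kN; rewrite /= /step_size !add0n divff ?pnatr_eq0//.
  rewrite subrr mul0r expr1n -[(1 + 2)%N]/3%N.
  by move: (f _ - f _) => u; lra.
apply: le_trans (contract _ kN) _.
have := IH (ltnW kN); move: (f _ - f _) => u uk.
have /andP[s0 s1] := step_size_bounds k.+1.
have s1' : 0 <= 1 - step_size R k.+1 by rewrite subr_ge0.
apply: le_trans (_ : _ <= (1 - step_size R k.+1) * (8 * C / (k.+1 + 2)%:R)
  + 2 * step_size R k.+1 ^+ 2 * C) _; first by rewrite lerD2r ler_wpM2l.
rewrite /step_size (_ : (k.+2 + 2)%:R = (k.+1 + 2)%:R + 1 :> R); last first.
  by rewrite -[1]/(1%:R) -natrD addn1.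
have m0 : 0 < (k.+1 + 2)%:R :> R by rewrite ltr0n.
move: ((k.+1 + 2)%:R : R) m0 => m m0.
(* With m = k+3: 8C/(m+1) - (1 - 2/m) 8C/m - 8C/m^2 = 8C/(m^2 (m+1)). *)
rewrite -subr_ge0 (_ : _ - _ = 8 * C / (m ^+ 2 * (m + 1))); last first.
  by field; rewrite !gt_eqF// ltr_wpDr.
by rewrite divr_ge0 ?mulr_ge0 ?addr_ge0 ?exprn_ge0// ltW.
Qed.

Lemma descent_telescope (h : nat -> R) (d : R) (k m : nat) :
  (forall j, (j < m)%N -> h (k + j).+1 <= h (k + j)%N - d) ->
  h (k + m)%N <= h k - d *+ m.
Proof.
elim: m => [|m IH] hd; first by rewrite addn0 mulr0n subr0.
rewrite addnS mulrSr; apply: le_trans (hd m (ltnSn m)) _.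
rewrite opprD addrA lerD2r; apply: IH => j jm.
exact: hd (ltnW _).
Qed.

Lemma gap_K_ge C eps : 0 <= C -> 0 < eps -> 8 * C <= eps * (gap_K C eps)%:R.
Proof.
move=> C0 e0; rewrite [eps * _]mulrC -ler_pdivrMr// /gap_K natr_absz.
by apply: le_trans (ceil_ge _) _; rewrite ler_int ler_norm.
Qed.

Lemma gap_K_lt C eps : 0 <= C -> 0 < eps ->
  (gap_K C eps)%:R < 8 * C / eps + 1.
Proof.
move=> C0 e0; rewrite /gap_K natr_absz ger0_norm.
  by rewrite -ltrBlDr -[1]/(1%:~R) -intrB gt_pred_ceil.
by rewrite ceil_ge0 (lt_le_trans (ltrN10 _))// divr_ge0 ?mulr_ge0// ltW.
Qed.

(** Starting the count at K+1 rather than K also covers K = 0, where the primal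
    bound is not available at the initial point. *)
Lemma greedy_gap f C (Xopt : symmat R n) (X : nat -> symmat R n) (eps : R)
    (K := gap_K C eps) :
  convex_function setT f -> (forall Y, differentiable f Y) ->
  curvature f = C%:E -> is_optimal f Xopt -> 0 < eps -> box (X 0%N) ->
  (forall k, (k <= 2 * K + 1)%N ->
     greedy_step f C (gap_step_size R K k) (X k) (X k.+1)) ->
  exists2 k, (k <= 2 * K + 1)%N & gap f (X k) <= eps.
Proof.
move=> cf df fC [bopt opt] e0 X0 Xs; have C0 := curvature_ge0 f C fC.
apply: contrapT => noK.
have gap_gt k : (k <= 2 * K + 1)%N -> eps < gap f (X k).
  by move=> kK; rewrite ltNge; apply/negP => gk; apply: noK; exists k.
have s01 k : 0 < gap_step_size R K k <= 1 by exact: step_size_bounds.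
have bX k : (k <= (2 * K + 1).+1)%N -> box (X k).
  by apply: greedy_box s01 X0 _ k => k; rewrite ltnS; exact: Xs.
set a := step_size R K; have /andP[a0 a1] : 0 < a <= 1 := step_size_bounds K.
have hK : f (X K.+1) - f Xopt <= 8 * C / (K.+1 + 2)%:R.
  apply: (greedy_primal_rate f C Xopt X K.+1) => //; last by rewrite /=.
  move=> k; rewrite ltnS => kK.
  have := Xs k; rewrite /gap_step_size kK; apply.
  by rewrite (leq_trans kK)// mul2n -addnn -addnA leq_addr.
have hend : f Xopt <= f (X (K.+1 + K.+1)%N).
  apply/opt/bX; rewrite addSn addnS addn1 mul2n addnn; exact: leqnn.
have := descent_telescope (f \o X) (a * eps - 2 * a ^+ 2 * C) K.+1 K.+1.
have a2 : a * (K + 2)%:R = 2 by rewrite /a /step_size divfK// pnatr_eq0 addn2.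
have C8 : 8 * C <= eps * K%:R := gap_K_ge _ _ C0 e0.
have desc j : (j < K.+1)%N -> (f \o X) (K.+1 + j).+1 <=
    (f \o X) (K.+1 + j)%N - (a * eps - 2 * a ^+ 2 * C).
  move=> jK; have kK : (K.+1 + j <= 2 * K + 1)%N.
    by rewrite addn1 addSn ltnS mul2n -addnn leq_add2l.
  have := greedy_step_descent f C _ _ _ fC (s01 _) (bX _ (leqW kK)) (Xs _ kK).
  have -> : gap_step_size R K (K.+1 + j) = a.
    by rewrite /gap_step_size addSn ltnNge leq_addr.
  have : a * eps <= a * gap f (X (K.+1 + j)%N) by rewrite ler_wpM2l ?ltW ?gap_gt.
  by rewrite [(f \o X) _]/comp [(f \o X) (K.+1 + j)%N]/comp; lra.
move=> /(_ desc) /=; move: hend hK; move: (f _) (f _) (f _) => u v w.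
have K3 : 8 * C / (K.+1 + 2)%:R <= 4 * a * C.
  have -> : 4 * a * C = 8 * C / (K + 2)%:R by rewrite /a /step_size; lra.
  by rewrite ler_wpM2l ?mulr_ge0// lef_pV2 ?posrE ?ltr0n ?addnS// ler_nat.
move=> hend hK tele.
(* Telescoping turns into (eps - 2 a C) (K+1) <= 4 C after dividing by a. *)
have : (a * eps - 2 * a ^+ 2 * C) * (K%:R + 1) <= 4 * a * C.
  by rewrite natr1 mulr_natr; lra.
have -> : a * eps - 2 * a ^+ 2 * C = a * (eps - 2 * a * C) by ring.
have -> : 4 * a * C = a * (4 * C) by ring.
rewrite -mulrA ler_pM2l// => {}tele.
have aK : a * (K%:R + 1) <= 2.
  by rewrite natrD in a2; lra.
have : 2 * C * (a * (K%:R + 1)) <= 2 * C * 2 by rewrite ler_wpM2l ?mulr_ge0.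
by lra.
Qed.

(** For eps <= 1 the number of steps is at most
    2 (8C/eps + 1) + 1 <= (16 C + 3)/eps. *)
Lemma gap_steps_bigO C : 0 <= C ->
  ((fun eps : R => (2 * gap_K C eps + 1)%:R : R^o) =O_ (0^'+)
     (fun eps : R => eps^-1 : R^o)).
Proof.
move=> C0; apply/eqO_exP; exists (16 * C + 3); first by rewrite ltr_wpDl ?mulr_ge0.
near=> e.
have e0 : 0 < e by [].
have e1 : e <= 1 by near: e; exact: nbhs_right_le.
have e1' : 1 <= e^-1 by rewrite invf_ge1.
have := gap_K_lt _ _ C0 e0.
rewrite !ger0_norm ?invr_ge0 ?(ltW e0)// natrD natrM; lra.
Unshelve. all: by end_near.
Qed.

End greedy.

Theorem theorem25 (R : realType) (n : nat) (f : symmat R n -> R^o) (C : R)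
    (Xopt : symmat R n)
    (f_convex : convex_function setT f)
    (f_diff : forall X : symmat R n, differentiable f X)
    (f_curvature : curvature f = C%:E)
    (Xopt_optimal : is_optimal f Xopt) :
  (forall X : nat -> symmat R n,
     greedy_init (X 0%N) ->
     (forall k, greedy_step f C (step_size R k) (X k) (X k.+1)) ->
     forall k, (1 <= k)%N -> f (X k) - f Xopt <= 8 * C / (k + 2)%:R) /\
  (forall eps : R, 0 < eps ->
     let K := gap_K C eps in
     forall X : nat -> symmat R n,
     greedy_init (X 0%N) ->
     (forall k, (k <= 2 * K + 1)%N ->
        greedy_step f C (gap_step_size R K k) (X k) (X k.+1)) ->
     exists2 k, (k <= 2 * K + 1)%N & gap f (X k) <= eps) /\
  ((fun eps : R => (2 * gap_K C eps + 1)%:R : R^o) =O_ (0^'+)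
     (fun eps : R => eps^-1 : R^o)).
Proof.
have [Xopt_box _] := Xopt_optimal; split; [|split] => [X X0 Xs k k1|eps e0 K X X0 Xs|].
- apply: (greedy_primal_rate R n f C Xopt X k) => //; last by rewrite k1 leqnn.
  exact: greedy_init_box.
- exact: (greedy_gap R n f C Xopt X eps f_convex f_diff f_curvature Xopt_optimal e0
    (greedy_init_box R n _ X0) Xs).
- exact: gap_steps_bigO (curvature_ge0 R n f C f_curvature).
Qed.
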